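(* For every integer $n\ge 1$, the number of different words of length $n$ of the form $$\sigma^j\tau^{n_1}\sigma\tau^{n_2}\cdots\sigma\tau^{n_k}\qquad (j\in\{0,1\},\ k\ge 1,\ n_1,\dots,n_k\ge 1)$$ is equal to the Fibonacci number $F_n$.
   Context: Words are formal strings in the two letters $\sigma$ and $\tau$; the length of a word is its total number of letters (so the displayed word has length $j+(k-1)+n_1+\cdots+n_k$). The Fibonacci numbers are given by $F_0=F_1=1$ and $F_{n+2}=F_{n+1}+F_n$. *)

(* Defs.v *)
From HB Require Import structures.
From mathcomp Require Import all_boot.
From mathcomp Require Import boolp.

Set Implicit Arguments.
Unset Strict Implicit.
Unset Printing Implicit Defensive.

Inductive letter : Type := sigma | tau.

Definition bool_of_letter (a : letter) : bool := if a is tau then true else false.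
Definition letter_of_bool (b : bool) : letter := if b then tau else sigma.

Lemma bool_of_letterK : cancel bool_of_letter letter_of_bool.
Proof. by case. Qed.

HB.instance Definition _ := Finite.copy letter (can_type bool_of_letterK).

(* The word sigma^j tau^(m 1) sigma tau^(m 2) ... sigma tau^(m k); the values
   m i with i = 0 or i > k are irrelevant. *)
Definition block_word (j k : nat) (m : nat -> nat) : seq letter :=
  nseq j sigma ++ nseq (m 1) tau ++
    \big[cat/[::]]_(2 <= i < k.+1) (sigma :: nseq (m i) tau).

Definition has_block_form (w : seq letter) : Prop :=
  exists (j k : nat) (m : nat -> nat),
    [/\ j = 0 \/ j = 1,
        1 <= k,
        forall i, 1 <= i <= k -> 1 <= m i
      & w = block_word j k m].

(* Indexed so that fib 0 = fib 1 = 1. *)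
Fixpoint fib (n : nat) : nat :=
  if n is n1.+1 then
    if n1 is n2.+1 then fib n1 + fib n2 else 1
  else 1.

(* Main.v *)
(** The words in question are exactly the nonempty words that end in [tau] and
    have no two adjacent [sigma]s. Such a word starts with [tau] or with
    [sigma tau], and what follows is an arbitrary word of the same kind or the
    empty word; this gives the Fibonacci recursion once the empty word is
    counted in length 0. *)
Require Import Defs.
From mathcomp Require Import all_boot.
From mathcomp Require Import boolp.

(* Starting the path at [tau] puts no constraint on the first letter, and lets
   the empty word be tau-ended. *)
Definition sparse (w : seq letter) : bool :=
  path (fun a b => bool_of_letter a || bool_of_letter b) tau w
  && bool_of_letter (last tau w).

(** A sparse [u] is empty or ends in [tau], so the junction never puts two [sigma]s side by side. *)
Lemma sparse_cat u v : sparse u -> sparse v -> sparse (u ++ v).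
Proof.
rewrite /sparse cat_path last_cat => /andP[-> lu].
by case: (last tau u) lu.
Qed.

Lemma sparse_nseq_tau n : sparse (nseq n tau).
Proof. by elim: n. Qed.

Lemma sparse_sigma_nseq_tau n : 0 < n -> sparse (sigma :: nseq n tau).
Proof. by case: n => // n _; exact: sparse_nseq_tau. Qed.

Lemma sparse_ind (P : seq letter -> Prop) :
    P [::] -> (forall w, sparse w -> P w -> P (tau :: w)) ->
    (forall w, sparse w -> P w -> P [:: sigma, tau & w]) ->
  forall w, sparse w -> P w.
Proof.
(* Strong induction on length, since the [sigma tau] case removes two letters at once. *)
move=> P0 Pt Pst w; have [n] := ubnP (size w).
elim: n w => // n IHn [|[[|[] w]|w]] // size_w sw.
- by apply: Pst => //; apply: IHn => //; apply: ltnW.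
- by apply: Pt => //; apply: IHn.
Qed.

Lemma block_word_sparse (j k : nat) (m : nat -> nat) :
    j = 0 \/ j = 1 -> 1 <= k -> (forall i, 1 <= i <= k -> 1 <= m i) ->
  sparse (block_word j k m).
Proof.
move=> j01 k_gt0 m_gt0; rewrite /block_word catA; apply: sparse_cat.
  case: j01 => ->; first exact: sparse_nseq_tau.
  by apply: sparse_sigma_nseq_tau; apply: m_gt0; rewrite leqnn.
rewrite big_nat; apply: (big_ind (fun w => sparse w)) => // [|i /andP[i_gt1 i_le_k]].
  exact: sparse_cat.
by apply: sparse_sigma_nseq_tau; apply: m_gt0; rewrite ltnW.
Qed.

Lemma block_word_tau_cons k m :
  tau :: block_word 0 k m =
  block_word 0 k (fun i => if i == 1 then (m 1).+1 else m i).
Proof.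
rewrite /block_word /=; congr (_ :: _ ++ _).
by apply: eq_big_nat => -[|[|i]].
Qed.

(** The leading [tau] becomes a new first block of length 1, and the old blocks move up by one
    index. *)
Lemma block_word_tau_sigma_cons k m : 1 <= k ->
  [:: tau, sigma & block_word 0 k m] =
  block_word 0 k.+1 (fun i => if i == 1 then 1 else m i.-1).
Proof.
move=> k_gt0; rewrite /block_word /= [in RHS]big_ltn //= [in RHS]big_add1 /=.
congr [:: _, _ & _ ++ _].
by apply: eq_big_nat => -[|[|i]].
Qed.

(** The extra [tau] forces [j = 0] and turns the empty word into a single block, so the induction
    can start from [[::]]. *)
Lemma sparse_tau_block_word w : sparse w ->
  exists k m, [/\ 1 <= k, forall i, 1 <= i <= k -> 1 <= m i
                & tau :: w = block_word 0 k m].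
Proof.
elim/sparse_ind => [|{}w _ [k [m [k_gt0 m_gt0 Ew]]]|{}w _ [k [m [k_gt0 m_gt0 Ew]]]].
- by exists 1, (fun=> 1); split=> //; rewrite /block_word big_geq.
- rewrite Ew block_word_tau_cons; exists k; eexists; split; [by [] | | reflexivity].
  by move=> i /m_gt0; case: eqP.
- rewrite Ew block_word_tau_sigma_cons //.
  exists k.+1; eexists; split; [by [] | | reflexivity].
  by case=> [|[|i]] //= lt_ik; exact: m_gt0.
Qed.

Lemma has_block_formP w : w <> [::] -> has_block_form w <-> sparse w.
Proof.
move=> w0; split=> [[j [k [m [j01 k_gt0 m_gt0 ->]]]]|].
  exact: block_word_sparse.
(* Either [w] starts with [tau] and [j = 0], or it starts with [sigma tau] and the [sigma] is split
   off as [j = 1]. *)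
case: w w0 => [//|[[|[] w]|w]] // _ sw;
  have [k [m [k_gt0 m_gt0 Ew]]] := sparse_tau_block_word w sw.
- by exists 1, k, m; split=> //; [right | rewrite Ew].
- by exists 0, k, m; split=> //; left.
Qed.

(** The two branches follow the cases of [sparse_ind], so the lengths satisfy the recursion of
    [fib]. *)
Fixpoint sparse_words (n : nat) : seq (seq letter) :=
  if n is n1.+1 then
    if n1 is n2.+1 then
      map (cons tau) (sparse_words n1) ++
      map (fun w => [:: sigma, tau & w]) (sparse_words n2)
    else [:: [:: tau]]
  else [:: [::]].

Lemma size_sparse_words n : size (sparse_words n) = fib n.
Proof.
suff [] : size (sparse_words n) = fib n /\ size (sparse_words n.+1) = fib n.+1.
  by [].
elim: n => [//|n [IHn IHn1]]; split=> //.
by rewrite [sparse_words _]/= size_cat !size_map IHn -/(sparse_words n.+1) IHn1.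
Qed.

Lemma mem_sparse_words n w : (w \in sparse_words n) = (size w == n) && sparse w.
Proof.
have tau_inj : injective (cons tau) by move=> u v [].
have sigmatau_inj : injective (fun u => [:: sigma, tau & u]) by move=> u v [].
(* The recursion reaches back two steps, so two consecutive lengths are carried through the
   induction. *)
suff [] : (forall w, (w \in sparse_words n) = (size w == n) && sparse w) /\
    (forall w, (w \in sparse_words n.+1) = (size w == n.+1) && sparse w).
  by [].
elim: n {w} => [|n [IHn IHn1]].
  by split=> [[|a w]|[|[] [|[] w]]].
split=> // w; rewrite [sparse_words _]/= -/(sparse_words n.+1) mem_cat.
have tauE u : (tau :: u \in map (cons tau) (sparse_words n.+1)) =
    (u \in sparse_words n.+1) by rewrite mem_map.
have sigmatauE u : ([:: sigma, tau & u] \in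
    map (fun w => [:: sigma, tau & w]) (sparse_words n)) = (u \in sparse_words n).
  by rewrite (mem_map sigmatau_inj).
have not_tau u : (forall v, u <> tau :: v) ->
    (u \in map (cons tau) (sparse_words n.+1)) = false.
  by move=> ne; apply/mapP => -[v _ /ne].
have not_sigmatau u : (forall v, u <> [:: sigma, tau & v]) ->
    (u \in map (fun w => [:: sigma, tau & w]) (sparse_words n)) = false.
  by move=> ne; apply/mapP => -[v _ /ne].
case: w => [|[[|[] w]|w]].
- by rewrite not_tau ?not_sigmatau.
- by rewrite not_tau ?not_sigmatau ?andbF.
- by rewrite not_tau ?not_sigmatau ?andbF.
- by rewrite not_tau // sigmatauE IHn.
- by rewrite tauE not_sigmatau // orbF IHn1.
Qed.

Lemma uniq_sparse_words n : uniq (sparse_words n).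
Proof.
suff [] : uniq (sparse_words n) /\ uniq (sparse_words n.+1) by [].
elim: n => [//|n [IHn IHn1]]; split=> //.
rewrite [sparse_words _]/= -/(sparse_words n.+1) cat_uniq.
rewrite !map_inj_uniq ?IHn ?IHn1 ?andbT; try by move=> u v [].
(* The two branches are disjoint because their words differ in the first letter. *)
by apply/hasPn => _ /mapP[u _ ->]; apply/mapP => -[].
Qed.

Theorem theorem4p2 (n : nat) (hn : 1 <= n) :
  #|[set w : n.-tuple letter | `[< has_block_form w >]]| = fib n.
Proof.
rewrite -size_sparse_words cardE -(size_map val); apply/perm_size/uniq_perm.
- by rewrite map_inj_uniq ?enum_uniq //; exact: val_inj.
- exact: uniq_sparse_words.
(* Here [1 <= n] enters: the empty word is sparse but has no block form. *)
have tuple_neq0 (w : n.-tuple letter) : val w <> [::].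
  by move=> w0; move: hn; rewrite -(size_tuple w) /= w0.
move=> w; rewrite mem_sparse_words; apply/mapP/andP => [[t + ->]|[sz_w sw]].
  rewrite mem_enum inE => /asboolP /(has_block_formP _ (tuple_neq0 t)) st.
  by rewrite size_tuple.
exists (Tuple sz_w) => //; rewrite mem_enum inE; apply/asboolP.
by apply/has_block_formP => //; apply: (tuple_neq0 (Tuple sz_w)).
Qed.
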